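(* Let $G$ be a $\Delta$-regular graph of order $n$ with independence number $\alpha<n$, and let $K_3(G)$ denote the number of triangles in $G$. (1) If $G$ is vertex-transitive, then $$6K_3(G)\leq n\Delta^2\,\frac{n-2\alpha}{n-\alpha}.$$ (2) If $G$ is nonedge-transitive and $\alpha\geq2$, then $$6K_3(G)\leq n\Delta\left(\Delta-1-\frac{(n-\Delta-1)\bigl(\alpha(\Delta+1)-n\bigr)}{(\alpha-1)(n-\alpha)}\right).$$
   Context: Graphs are finite and simple. $G$ is vertex-transitive if for any two vertices $u,v$ there is an automorphism of $G$ mapping $u$ to $v$. A nonedge of $G$ is an unordered pair of distinct non-adjacent vertices. $G$ is nonedge-transitive if for any two nonedges $\{u_1,v_1\},\{u_2,v_2\}$ there is an automorphism $f$ of $G$ with $f(\{u_1,v_1\})=\{u_2,v_2\}$; equivalently, the complement of $G$ is edge-transitive. *)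

(* Defs.v *)
From mathcomp Require Import all_boot all_order all_fingroup all_algebra.

Set Implicit Arguments.
Unset Strict Implicit.
Unset Printing Implicit Defensive.

(* A finite simple graph is given by its adjacency relation
   e : rel T on the finType T of vertices; symmetry and irreflexivity of e are
   separate hypotheses. *)

Section Graph.
Variables (T : finType) (e : rel T).

Definition regular (d : nat) : Prop := forall x : T, #|[set y | e x y]| = d.

Definition independent (S : {set T}) : bool :=
  [forall x in S, forall y in S, ~~ e x y].

Definition independence_number : nat :=
  \max_(S : {set T} | independent S) #|S|.

Definition triangle (S : {set T}) : bool :=
  (#|S| == 3) && [forall x in S, forall y in S, (x != y) ==> e x y].

Definition num_triangles : nat := #|[set S : {set T} | triangle S]|.

Definition automorphism (f : {perm T}) : Prop :=
  forall x y : T, e (f x) (f y) = e x y.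

Definition vertex_transitive : Prop :=
  forall u v : T, exists f : {perm T}, automorphism f /\ f u = v.

Definition nonedge (u v : T) : bool := (u != v) && ~~ e u v.

(* Nonedges are unordered, so f may map u1 to v2 and v1 to u2. *)
Definition nonedge_transitive : Prop :=
  forall u1 v1 u2 v2 : T, nonedge u1 v1 -> nonedge u2 v2 ->
  exists f : {perm T},
    automorphism f /\ f @: [set u1; v1] = [set u2; v2].

End Graph.

(* Main.v *)
Require Import Defs.
From mathcomp Require Import all_boot all_order all_fingroup all_algebra.
From mathcomp Require Import lra zify.
Import Order.TTheory GRing.Theory Num.Theory.
Local Open Scope ring_scope.

(** Fix a maximum independent set [S] and let [a x] be the number of neighbours
of [x] in [S].  As [S] is independent, [a] vanishes on [S], so its sum
[#|S| * Delta] is spread over only [n - #|S|] vertices, and Cauchy-Schwarz gives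
[(#|S| * Delta) ^ 2 <= (n - #|S|) * \sum_x a x ^ 2] ([sum_nbr_in_sqr_ge]).
Both bounds come from this inequality, by relating the sum of squares to
triangles in two ways.

- If [y] is in [S] and [x] is adjacent to [y], no common neighbour of [x] and
  [y] lies in [S], so there are at most [Delta - a x] of them.  Summing over
  such pairs, the closed 3-walks starting in [S] number at most
  [#|S| * Delta ^ 2 - \sum_x a x ^ 2] ([sum_closed_walks3_indep]).  Under vertex
  transitivity every vertex starts equally many closed 3-walks, so [S] starts a
  proportion [#|S| / n] of all [6 K3] of them.

- The sum of squares counts the 2-walks with both ends in [S]
  ([sum_nbr_in_sqr]).  Apart from the [#|S| * Delta] closed ones, their ends
  form nonedges.  Under nonedge transitivity all nonedges have the same number
  [c] of common neighbours, so Cauchy-Schwarz bounds [c] from below.  A 2-walk in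
  the whole graph is closed, or joins the ends of a nonedge, or extends to a
  closed 3-walk; so
  [n * Delta ^ 2 = 6 K3 + n * Delta + n * (n - Delta - 1) * c], and the lower
  bound on [c] is an upper bound on [K3]. *)

(** * Cauchy-Schwarz over a finite set *)

(** Summing [2 * (a x * a y) <= a x ^ 2 + a y ^ 2] over all pairs [(x, y)] gives
twice the inequality. *)
Lemma sum_sqr_Cauchy (I : finType) (A : {set I}) (a : I -> nat) :
  ((\sum_(x in A) a x) ^ 2 <= #|A| * \sum_(x in A) a x ^ 2)%N.
Proof.
have double : (\sum_(x in A) \sum_(y in A) (a x ^ 2 + a y ^ 2) =
    2 * (#|A| * \sum_(x in A) a x ^ 2))%N.
  under eq_bigr => x _ do rewrite big_split /= sum_nat_const.
  by rewrite big_split /= sum_nat_const -big_distrr /=; lia.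
rewrite -(leq_pmul2l (isT : 0 < 2)%N) -double -mulnn big_distrlr big_distrr /=.
apply: leq_sum => x _; rewrite big_distrr; apply: leq_sum => y _.
exact: nat_Cauchy.
Qed.

(** * Walks of length two and three *)

Section Walks.
Set Implicit Arguments.
Unset Strict Implicit.
Local Open Scope nat_scope.
Variables (T : finType) (e : rel T).
Hypotheses (e_sym : symmetric e) (e_irr : irreflexive e).

Definition codegree (x y : T) : nat := \sum_z e x z * e z y.

Definition closed_walks3 (x : T) : nat := \sum_y e x y * codegree x y.

Definition nbr_in (S : {set T}) (x : T) : nat := \sum_(y in S) e x y.

Lemma codegreeC x y : codegree x y = codegree y x.
Proof.
apply: eq_bigr => z _.
by rewrite mulnC (e_sym z y) (e_sym x z).
Qed.

Lemma codegree_automorphism (f : {perm T}) x y :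
  automorphism e f -> codegree (f x) (f y) = codegree x y.
Proof.
move=> fA; rewrite /codegree (reindex_inj (@perm_inj _ f)) /=.
by apply: eq_bigr => z _; rewrite !fA.
Qed.

Lemma closed_walks3_automorphism (f : {perm T}) x :
  automorphism e f -> closed_walks3 (f x) = closed_walks3 x.
Proof.
move=> fA; rewrite /closed_walks3 (reindex_inj (@perm_inj _ f)) /=.
by apply: eq_bigr => y _; rewrite fA codegree_automorphism.
Qed.

Lemma nonedge_transitive_codegree u1 v1 u2 v2 :
  nonedge_transitive e -> nonedge e u1 v1 -> nonedge e u2 v2 ->
  codegree u1 v1 = codegree u2 v2.
Proof.
move=> trans ne1 ne2; have [f [fA fE]] := trans _ _ _ _ ne1 ne2.
rewrite -(codegree_automorphism u1 v1 fA).
have fu : f u1 \in [set u2; v2] by rewrite -fE imset_f ?set21.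
have fv : f v1 \in [set u2; v2] by rewrite -fE imset_f ?set22.
have ne_f : f u1 != f v1 by rewrite (inj_eq perm_inj); case/andP: ne1.
(* [f] may exchange the ends of the nonedge, and then [codegreeC] applies. *)
case/set2P: fu ne_f => ->; case/set2P: fv => ->; rewrite ?eqxx //.
by rewrite codegreeC.
Qed.

(** A triangle is the trace of six closed 3-walks, one for each ordering of its
three vertices. *)
Lemma sum_closed_walks3 : \sum_x closed_walks3 x = 6 * num_triangles e.
Proof.
pose walk x y z := [&& e x y, e x z & e z y].
have triangle_walk x y z : walk x y z -> triangle e [set x; y; z].
  case/and3P=> exy exz ezy.
  have adjC u v : e u v -> (u != v) * e v u * e u v.
    by move=> euv; rewrite e_sym euv; case: eqP euv => // ->; rewrite e_irr.
  rewrite /triangle -setUA cardsU1 cards2 !inE negb_or.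
  rewrite (adjC _ _ exy) (adjC _ _ exz) [y == z]eq_sym (adjC _ _ ezy) /=.
  apply/forall_inP => u; rewrite !inE => /or3P[] /eqP->;
  apply/forall_inP => v; rewrite !inE => /or3P[] /eqP->;
  by rewrite ?eqxx // ?(adjC _ _ exy) ?(adjC _ _ exz) ?(adjC _ _ ezy) ?implybT.
(* For a fixed triangle [S], the walks in it are the choices of a vertex, then
   of a second one, then of a third one: 3 * 2 * 1 of them. *)
have walk_in (S : {set T}) x y z : triangle e S ->
  (walk x y z && (S == [set x; y; z])) =
  [&& x \in S, y \in S :\ x & z \in S :\ x :\ y].
  case/andP=> /eqP cardS /forall_inP adjS.
  have adj u v : u \in S -> v \in S -> u != v -> e u v.
    by move=> uS vS; apply/implyP; move/forall_inP: (adjS u uS); apply.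
  apply/andP/and3P => [[w /eqP SE] | [xS]].
    have := triangle_walk _ _ _ w; case/andP: (w) => exy /andP[exz ezy] _.
    have ne u v : e u v -> u != v by apply: contraTneq => ->; rewrite e_irr.
    rewrite SE !inE !eqxx ?orbT (ne _ _ ezy) [y == x]eq_sym (ne _ _ exy).
    by rewrite [z == x]eq_sym (ne _ _ exz).
  rewrite !inE => /andP[yx yS] /and3P[zy zx zS]; split.
    by rewrite /walk !adj // eq_sym.
  rewrite eq_sym eqEcard cardS !subUset !sub1set xS yS zS /=.
  by rewrite -setUA cardsU1 cards2 !inE negb_or !(eq_sym x) yx zx (eq_sym y) zy.
transitivity (\sum_x \sum_y \sum_z \sum_(S | triangle e S)
                (walk x y z && (S == [set x; y; z]) : nat)).
  apply: eq_bigr => x _; apply: eq_bigr => y _; rewrite big_distrr /=.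
  apply: eq_bigr => z _; rewrite !mulnb -/(walk x y z).
  have [w|_] := boolP (walk x y z); last by rewrite big1.
  rewrite (bigD1 [set x; y; z]) ?triangle_walk //= eqxx big1 // => S.
  by case/andP=> _ /negbTE->.
under eq_bigr => x _ do under eq_bigr => y _ do rewrite exchange_big.
under eq_bigr => x _ do rewrite exchange_big.
rewrite exchange_big /= /num_triangles mulnC -sum_nat_const big_set /=.
apply: eq_bigr => S triS; have /andP[/eqP cardS _] := triS.
transitivity (\sum_(x in S) \sum_(y in S :\ x) \sum_(z in S :\ x :\ y) 1).
  rewrite [RHS]big_mkcond; apply: eq_bigr => x _.
  have [xS | /negbTE xS] := boolP (x \in S); last first.
    by rewrite big1 // => y _; rewrite big1 // => z _; rewrite walk_in // xS.
  rewrite [RHS]big_mkcond; apply: eq_bigr => y _.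
  have [yS | /negbTE yS] := boolP (y \in S :\ x); last first.
    by rewrite big1 // => z _; rewrite walk_in // yS andbF.
  rewrite [RHS]big_mkcond; apply: eq_bigr => z _.
  by rewrite walk_in // xS yS /=; case: ifP.
under eq_bigr => x xS.
  under eq_bigr => y yS.
    rewrite sum1_card (_ : #|_| = 1); last first.
      by have := cardsD1 y (S :\ x); have := cardsD1 x S; rewrite xS yS; lia.
    over.
  rewrite sum1_card (_ : #|_| = 2); last first.
    by have := cardsD1 x S; rewrite xS; lia.
  over.
by rewrite sum_nat_const cardS.
Qed.

(** * Regular graphs *)

Section Regular.
Variable Delta : nat.
Hypothesis e_reg : regular e Delta.

Lemma sum_adj x : \sum_y (e x y : nat) = Delta.
Proof.
rewrite -(e_reg x) -sum1dep_card [RHS]big_mkcond.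
by apply: eq_bigr => y _; case: (e x y).
Qed.

Lemma codegreexx x : codegree x x = Delta.
Proof.
rewrite -(sum_adj x); apply: eq_bigr => z _.
by rewrite (e_sym z) mulnb andbb.
Qed.

Lemma sum_codegree x : \sum_y codegree x y = Delta ^ 2.
Proof.
rewrite exchange_big /= -mulnn -{1}(sum_adj x) big_distrl.
by apply: eq_bigr => z _; rewrite -big_distrr sum_adj.
Qed.

Lemma card_nonedges x : #|[set y | nonedge e x y]| + Delta + 1 = #|T|.
Proof.
rewrite -(e_reg x) -(cardsC [set y | e x y]) (cardsD1 x (~: _)) !inE e_irr /=.
rewrite (_ : ~: _ :\ x = [set y | nonedge e x y]); first by lia.
by apply/setP => y; rewrite !inE /nonedge eq_sym.
Qed.

Section Independent.
Variable S : {set T}.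
Hypothesis S_indep : independent e S.

Lemma independentP x y : x \in S -> y \in S -> e x y = false.
Proof.
move=> xS yS; apply/negbTE.
by move/forall_inP: S_indep => /(_ x xS) /forall_inP; apply.
Qed.

Lemma nbr_in_indep x : x \in S -> nbr_in S x = 0.
Proof. by move=> xS; rewrite /nbr_in big1 // => y yS; rewrite independentP. Qed.

(** Double count of the edges leaving [S]: none of them ends in [S], so the
vertices outside [S] account for all of them. *)
Lemma sum_nbr_in : \sum_(x in ~: S) nbr_in S x = #|S| * Delta.
Proof.
transitivity (\sum_x nbr_in S x).
  rewrite [LHS]big_mkcond; apply: eq_bigr => x _; rewrite inE.
  by case: ifPn => // /negbNE /nbr_in_indep ->.
rewrite exchange_big -sum_nat_const; apply: eq_bigr => y _.
by rewrite -(sum_adj y); apply: eq_bigr => x _; rewrite e_sym.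
Qed.

(** Cauchy-Schwarz over the complement of [S] alone: the factor [#|T| - #|S|],
instead of [#|T|], is what independence brings. *)
Lemma sum_nbr_in_sqr_ge :
  (#|S| * Delta) ^ 2 <= (#|T| - #|S|) * \sum_x nbr_in S x ^ 2.
Proof.
rewrite -sum_nbr_in; apply: leq_trans (sum_sqr_Cauchy _ _ _) _.
by rewrite cardsCs setCK leq_mul2l [leqRHS](bigID (mem (~: S))) leq_addr orbT.
Qed.

(** The sets of common neighbours of [x] and [y], and of neighbours of [x] in
[S], are disjoint parts of the neighbourhood of [x]. *)
Lemma codegree_indep x y : y \in S -> codegree y x + nbr_in S x <= Delta.
Proof.
move=> yS; rewrite -(sum_adj x) /nbr_in [X in _ + X]big_mkcond -big_split.
apply: leq_sum => z _ /=; rewrite (e_sym z x); case: ifP => [zS|_].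
  by rewrite independentP.
by rewrite addn0; case: (e y z); rewrite ?mul1n.
Qed.

(** Sum of [codegree_indep] over the pairs of adjacent [y] and [x] with [y] in
[S]; each [x] occurs in [nbr_in S x] such pairs, which makes the square. *)
Lemma sum_closed_walks3_indep :
  \sum_(y in S) closed_walks3 y + \sum_x nbr_in S x ^ 2 <= #|S| * Delta ^ 2.
Proof.
have -> : \sum_x nbr_in S x ^ 2 = \sum_(y in S) \sum_x e y x * nbr_in S x.
  rewrite exchange_big; apply: eq_bigr => x _.
  rewrite -mulnn {1}/nbr_in big_distrl.
  by apply: eq_bigr => y _; rewrite e_sym.
rewrite -big_split -sum_nat_const; apply: leq_sum => y yS /=.
rewrite -big_split -mulnn -{1}(sum_adj y) big_distrl; apply: leq_sum => x _ /=.
by rewrite -mulnDr leq_mul2l codegree_indep ?orbT.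
Qed.

End Independent.

(** Both sides count the 2-walks with both ends in [S], on the left by their
middle vertex, on the right by their ends. *)
Lemma sum_nbr_in_sqr (S : {set T}) :
  \sum_x nbr_in S x ^ 2 = \sum_(y in S) \sum_(z in S) codegree y z.
Proof.
under [RHS]eq_bigr => y _ do rewrite exchange_big.
rewrite [RHS]exchange_big; apply: eq_bigr => x _ /=.
rewrite -mulnn big_distrlr; apply: eq_bigr => y _; apply: eq_bigr => z _.
by rewrite (e_sym y x).
Qed.

(** * Consequences of transitivity *)

(** Every vertex starts equally many closed 3-walks, so the proportion of them
that start in [S] is the proportion of vertices in [S]. *)
Lemma vertex_transitive_triangles (S : {set T}) :
  vertex_transitive e -> #|T| * \sum_(y in S) closed_walks3 y =
    #|S| * (6 * num_triangles e).
Proof.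
move=> trans; rewrite -sum_closed_walks3.
have cst x y : closed_walks3 x = closed_walks3 y.
  by have [f [fA <-]] := trans x y; rewrite closed_walks3_automorphism.
have [->|[x0 _]] := set_0Vmem S; first by rewrite big_set0 cards0; lia.
rewrite (eq_bigr _ (fun y _ => cst y x0)) sum_nat_const.
rewrite [in RHS](eq_bigr _ (fun y _ => cst y x0)) sum_nat_const.
by rewrite mulnCA.
Qed.

Section ConstantCodegree.
Variable c : nat.
Hypothesis codegree_nonedge : forall x y, nonedge e x y -> codegree x y = c.

(** In an independent set all pairs of distinct vertices are nonedges, so the
2-walks between its vertices are counted by [c]. *)
Lemma sum_nbr_in_sqr_nonedge (S : {set T}) : independent e S ->
  \sum_x nbr_in S x ^ 2 = #|S| * (Delta + (#|S| - 1) * c).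
Proof.
move=> S_indep; rewrite sum_nbr_in_sqr -sum_nat_const; apply: eq_bigr => y yS.
rewrite (bigD1 y) //= codegreexx; congr (_ + _).
rewrite (cardsD1 y S) yS addnC addnK -sum_nat_const; apply: eq_big => z.
  by rewrite !inE andbC.
case/andP=> zS zy; apply: codegree_nonedge.
by rewrite /nonedge eq_sym zy (independentP S_indep).
Qed.

(** The 2-walks from [x] to [y] are classified by the pair of their ends: equal,
adjacent (then an edge back to [x] closes a triangle), or a nonedge. *)
Lemma nonedge_triangles : #|T| * Delta ^ 2 =
  6 * num_triangles e + #|T| * (Delta + (#|T| - Delta - 1) * c).
Proof.
rewrite -sum_closed_walks3 -!sum_nat_const -big_split; apply: eq_bigr => x _ /=.
rewrite -(sum_codegree x) (bigID (e x)) /=; congr (_ + _).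
  rewrite [LHS]big_mkcond; apply: eq_bigr => y _.
  by case: (e x y); rewrite ?mul1n.
rewrite (bigD1 x) ?e_irr //= codegreexx; congr (_ + _).
rewrite (_ : #|T| - Delta - 1 = #|[set y | nonedge e x y]|); last first.
  by have := card_nonedges x; lia.
rewrite -sum_nat_const; apply: eq_big => y.
  by rewrite inE /nonedge eq_sym andbC.
by case/andP=> exy yx; rewrite codegree_nonedge // /nonedge eq_sym yx.
Qed.

End ConstantCodegree.

End Regular.

(** * Maximum independent sets *)

Lemma independence_number_witness :
  exists2 S : {set T}, independent e S & #|S| = independence_number e.
Proof.
have indep0 : independent e set0 by apply/forall_inP => x; rewrite inE.
have [|S S_indep maxE] := @eq_bigmax_cond _ (independent e) (fun S => #|S|).
  by apply/card_gt0P; exists set0.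
by exists S.
Qed.

Lemma independence_number_gt0 : 0 < #|T| -> 0 < independence_number e.
Proof.
case/card_gt0P => x _; have x_indep : independent e [set x].
  apply/forall_inP => y /set1P->; apply/forall_inP => z /set1P->.
  by rewrite e_irr.
by apply: leq_trans (leq_bigmax_cond _ x_indep); rewrite cards1.
Qed.

End Walks.

(** * Bounds on the number of triangles *)

Theorem corollary22 (T : finType) (e : rel T) (n Delta alpha : nat)
    (e_sym : symmetric e) (e_irr : irreflexive e)
    (card_n : #|T| = n) (e_reg : regular e Delta)
    (alphaE : independence_number e = alpha) (alpha_lt_n : (alpha < n)%N) :
  (vertex_transitive e ->
     6%:R * (num_triangles e)%:R
       <= n%:R * Delta%:R ^+ 2 * ((n%:R - 2%:R * alpha%:R) / (n%:R - alpha%:R))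
       :> rat)
  /\
  (nonedge_transitive e -> (2 <= alpha)%N ->
     6%:R * (num_triangles e)%:R
       <= n%:R * Delta%:R *
          (Delta%:R - 1 -
             ((n%:R - Delta%:R - 1) * (alpha%:R * (Delta%:R + 1) - n%:R))
               / ((alpha%:R - 1) * (n%:R - alpha%:R)))
       :> rat).
Proof.
have [S S_indep] := independence_number_witness e; rewrite alphaE => cardS.
have alpha_gt0 : (0 < alpha)%N.
  by rewrite -alphaE independence_number_gt0 // card_n; lia.
have := sum_nbr_in_sqr_ge e_sym e_reg S_indep.
rewrite card_n cardS => cauchy.
have gap_gt0 : 0 < n%:R - alpha%:R :> rat by rewrite subr_gt0 ltr_nat.
have alphaR_gt0 : 0 < alpha%:R :> rat by rewrite ltr0n.
split=> [trans | trans alpha_ge2].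
- have := vertex_transitive_triangles e_sym e_irr S trans.
  have := sum_closed_walks3_indep e_sym e_reg S_indep.
  rewrite card_n cardS; move: cauchy.
  set q := (\sum_x nbr_in e S x ^ 2)%N; set w := (\sum_(y in S) _)%N.
  set k := num_triangles e => cauchy walks triangles.
  have bound : ((n - alpha) * (alpha * (6 * k)) + n * (alpha * Delta) ^ 2
                  <= n * ((n - alpha) * (alpha * Delta ^ 2)))%N.
    (* Weighted sum of the two inequalities that cancels [q]. *)
    apply: (@leq_trans (n * ((n - alpha) * (w + q)))).
      rewrite -triangles !mulnDr [X in (X + _)%N]mulnCA.
      by rewrite leq_add2l leq_mul2l cauchy orbT.
    by rewrite !leq_mul2l walks !orbT.
  move: bound.
  rewrite -(ler_nat rat) !(natrD, natrM, natrX) natrB ?(ltnW alpha_lt_n) //.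
  move=> bound; rewrite mulrA ler_pdivlMr // -(ler_pM2l alphaR_gt0).
  by nra.
- have [c codegree_c] :
      exists c, forall x y, nonedge e x y -> codegree e x y = c.
    (* As [2 <= #|S|], there is a nonedge inside [S] to read [c] from. *)
    have [u [v [uS vS uv]]] : exists u v, [/\ u \in S, v \in S & u != v].
      by apply/card_gt1P; rewrite cardS.
    have ne_uv : nonedge e u v by rewrite /nonedge uv (independentP S_indep).
    exists (codegree e u v) => x y ne_xy.
    exact: nonedge_transitive_codegree.
  have degree_lt : (Delta + 1 <= n)%N.
    have /card_gt0P[x _] : (0 < #|T|)%N by lia.
    by have := card_nonedges e_irr e_reg x; lia.
  have := nonedge_triangles e_sym e_irr e_reg codegree_c.
  move: cauchy; rewrite (sum_nbr_in_sqr_nonedge e_sym e_reg codegree_c S_indep).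
  rewrite card_n cardS; set k := num_triangles e => cauchy triangles.
  have {}cauchy : alpha%:R * Delta%:R ^+ 2 <=
      (n%:R - alpha%:R) * (Delta%:R + (alpha%:R - 1) * c%:R) :> rat.
    have : (alpha * Delta ^ 2 <= (n - alpha) * (Delta + (alpha - 1) * c))%N.
      by rewrite -(leq_pmul2l alpha_gt0) mulnA mulnn -expnMn [leqRHS]mulnCA.
    rewrite -(ler_nat rat) !(natrD, natrM, natrX).
    by rewrite !natrB ?(ltnW alpha_lt_n).
  have {}triangles : n%:R * Delta%:R ^+ 2 = 6%:R * k%:R +
      n%:R * (Delta%:R + (n%:R - Delta%:R - 1) * c%:R) :> rat.
    move/(congr1 (fun m => m%:R : rat)): triangles.
    by rewrite !(natrD, natrM, natrX) -subnDA natrB // natrD opprD addrA.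
  have pairs_gt0 : 0 < alpha%:R - 1 :> rat by rewrite subr_gt0 ltr1n.
  have c_ge : Delta%:R * (alpha%:R * (Delta%:R + 1) - n%:R) /
      ((alpha%:R - 1) * (n%:R - alpha%:R)) <= c%:R :> rat.
    by rewrite ler_pdivrMr ?mulr_gt0 //; lra.
  have nonedges_ge0 : 0 <= n%:R * (n%:R - Delta%:R - 1) :> rat.
    by rewrite mulr_ge0 // -addrA -opprD subr_ge0 -(natrD _ _ 1) ler_nat.
  have := ler_wpM2l nonedges_ge0 c_ge.
  by lra.
Qed.
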